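(* Let $p\colon\mathcal{M}\to\Delta^1$ be a cartesian fibration classifying a functor of quasicategories $g\colon\mathcal{D}\to\mathcal{C}$ via $v\colon\mathcal{D}\times\Delta^1\to\mathcal{M}$. Let $s\colon K\to\Delta^1$ be a map of simplicial sets with fibers $K_0,K_1$, and $i\colon K'\hookrightarrow K$ a monomorphism such that the map induced by $i$ on fibers over $\{1\}$ (of $s\circ i$ and $s$) is an isomorphism. Let $\tilde\alpha'\colon K'\to\mathcal{D}$ and $\alpha\colon K\to\mathcal{C}$ be maps, and put $\alpha'=\alpha\circ i$. Suppose that $\tilde\alpha'$ is adjunct to $\alpha'$ relative to $s\circ i$, and that $g$ admits a left adjoint at all vertices belonging to the image $\alpha(K_0)\subseteq\mathcal{C}$. Then there exists $\tilde\alpha\colon K\to\mathcal{D}$ with $\tilde\alpha\circ i=\tilde\alpha'$ such that $\tilde\alpha$ is adjunct to $\alpha$ relative to $s$. Furthermore, any two such lifts are equivalent as functors $K\to\mathcal{D}$.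
   Context: A cartesian fibration $p\colon\mathcal{M}\to\Delta^1$ classifies $g\colon\mathcal{D}\to\mathcal{C}$ via $v$ if (identifying $\mathcal{M}_0=\mathcal{C}$, $\mathcal{M}_1=\mathcal{D}$ by chosen isomorphisms) $v\colon\mathcal{D}\times\Delta^1\to\mathcal{M}$ is a map over $\Delta^1$ with $v|\mathcal{D}\times\{1\}=\mathrm{id}_{\mathcal{D}}$, $v|\mathcal{D}\times\{0\}=g$ and each edge $v|\{d\}\times\Delta^1$ $p$-cartesian. The functor $g$ admits a left adjoint at $c\in\mathcal{C}$ if $p$ admits a $p$-cocartesian lift of the nondegenerate edge of $\Delta^1$ with source $c\in\mathcal{M}_0$. For $s\colon K\to\Delta^1$ with fibers $K_0,K_1$, maps $\alpha\colon K\to\mathcal{C}$ and $\tilde\alpha\colon K\to\mathcal{D}$ are adjunct relative to $s$ if there is a map $A\colon K\times\Delta^1\to\mathcal{M}$ with $p\circ A=\mathrm{pr}_{\Delta^1}$ such that: (1) $A|K\times\{0\}=\alpha$; (2) $A|K\times\{1\}=\tilde\alpha$; (3) for each vertex $k\in K_0$, the image of $\{k\}\times\Delta^1$ under $A$ is $p$-cocartesian; (4) $A|K_1\times\Delta^1$ equals $K_1\times\Delta^1\hookrightarrow K\times\Delta^1\xrightarrow{\tilde\alpha\times\mathrm{id}}\mathcal{D}\times\Delta^1\xrightarrow{v}\mathcal{M}$. *)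

(* Defs.v *)
From HB Require Import structures.
From mathcomp Require Import all_boot.
From mathcomp Require Import boolp.
Set Implicit Arguments.
Unset Strict Implicit.
Unset Printing Implicit Defensive.

(* Throughout, [n] = {0, ..., n} is 'I_n.+1. Cartesian and cocartesian edges are
   defined by outer horn lifting, as in Kerodon (Definition 5.1.1.1). *)

(** * The simplex category *)

Record mono (m n : nat) := Mono {
  mono_ffun : {ffun 'I_m.+1 -> 'I_n.+1};
  _ : [forall i : 'I_m.+1, forall j : 'I_m.+1, (i <= j) ==> (mono_ffun i <= mono_ffun j)] }.

HB.instance Definition _ m n := [isSub for @mono_ffun m n].
HB.instance Definition _ m n := [Equality of mono m n by <:].

Definition mono_fun m n (f : mono m n) : 'I_m.+1 -> 'I_n.+1 := mono_ffun f.
Coercion mono_fun : mono >-> Funclass.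

Lemma mono_le m n (f : mono m n) (i j : 'I_m.+1) : i <= j -> f i <= f j.
Proof. exact: (implyP (forallP (forallP (valP f) i) j)). Qed.

Lemma monoP m n (f g : mono m n) : f =1 g -> f = g.
Proof. by move=> fg; apply/val_inj/ffunP. Qed.

Lemma mk_mono_subproof m n (f : 'I_m.+1 -> 'I_n.+1) :
  (forall i j : 'I_m.+1, i <= j -> f i <= f j) ->
  [forall i : 'I_m.+1, forall j : 'I_m.+1, (i <= j) ==> (finfun f i <= finfun f j)].
Proof.
by move=> fP; apply/forallP=> i; apply/forallP=> j; apply/implyP=> /fP; rewrite !ffunE.
Qed.

Definition mk_mono m n (f : 'I_m.+1 -> 'I_n.+1)
  (fP : forall i j : 'I_m.+1, i <= j -> f i <= f j) : mono m n := Mono (mk_mono_subproof fP).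

Lemma mk_monoE m n f fP i : @mk_mono m n f fP i = f i.
Proof. exact: ffunE. Qed.

Definition mono_id n : mono n n := mk_mono (fun (i j : 'I_n.+1) (le_ij : i <= j) => le_ij).

Definition mono_comp l m n (g : mono m n) (f : mono l m) : mono l n :=
  mk_mono (fun i j le_ij => mono_le g (mono_le f le_ij)).

Definition mono_cst m n (k : 'I_n.+1) : mono m n :=
  @mk_mono m n (fun=> k) (fun _ _ _ => leqnn k).

Lemma coface_subproof n (k : 'I_n.+2) (i j : 'I_n.+1) :
  i <= j -> lift k i <= lift k j.
Proof. by rewrite /= leq_bump2. Qed.

Definition coface n (k : 'I_n.+2) : mono n n.+1 := mk_mono (@coface_subproof n k).

Lemma mono_comp1 m n (f : mono m n) : mono_comp f (mono_id m) = f.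
Proof. by apply: monoP => i; rewrite !mk_monoE. Qed.

Lemma mono_1comp m n (f : mono m n) : mono_comp (mono_id n) f = f.
Proof. by apply: monoP => i; rewrite !mk_monoE. Qed.

Lemma mono_compA k l m n (h : mono m n) (g : mono l m) (f : mono k l) :
  mono_comp h (mono_comp g f) = mono_comp (mono_comp h g) f.
Proof. by apply: monoP => i; rewrite !mk_monoE. Qed.

Lemma mono_cst_comp l m n (k : 'I_n.+1) (f : mono l m) :
  mono_comp (mono_cst m k) f = mono_cst l k.
Proof. by apply: monoP => i; rewrite !mk_monoE. Qed.

(** * Simplicial sets and their maps *)

Record sset := SSet {
  simp :> nat -> Type;
  act : forall m n, mono m n -> simp n -> simp m;
  act_id : forall n (x : simp n), act (mono_id n) x = x;
  act_comp : forall l m n (g : mono m n) (f : mono l m) (x : simp n),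
    act (mono_comp g f) x = act f (act g x) }.

Record smap (X Y : sset) := SMap {
  sfun :> forall n, X n -> Y n;
  smap_act : forall m n (f : mono m n) (x : X n),
    sfun (act f x) = act f (sfun x) }.
Arguments sfun {X Y} _ n x.

Lemma smapP X Y (f g : smap X Y) : (forall n x, f n x = g n x) -> f = g.
Proof.
case: f g => [f fP] [g gP] /= fg.
have efg : f = g by apply: functional_extensionality_dep => n; apply: funext.
by rewrite -efg in gP *; rewrite (Prop_irrelevance fP gP).
Qed.

Definition sid X : smap X X := @SMap X X (fun _ x => x) (fun _ _ _ _ => erefl).

Lemma scomp_subproof X Y Z (g : smap Y Z) (f : smap X Y) m n (a : mono m n) x :
  g m (f m (act a x)) = act a (g n (f n x)).
Proof. by rewrite !smap_act. Qed.

Definition scomp X Y Z (g : smap Y Z) (f : smap X Y) : smap X Z :=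
  SMap (scomp_subproof g f).

Notation "g \os f" := (scomp g f) (at level 50, left associativity).

Definition is_siso X Y (f : smap X Y) :=
  exists g : smap Y X, g \os f = sid X /\ f \os g = sid Y.

Definition is_smono X Y (f : smap X Y) := forall n, injective (f n).

Definition vertex (X : sset) n (k : 'I_n.+1) (x : X n) : X 0 := act (mono_cst 0 k) x.
Definition source (X : sset) (e : X 1) : X 0 := vertex ord0 e.
Definition target (X : sset) (e : X 1) : X 0 := vertex ord_max e.
Definition degen (X : sset) (x : X 0) : X 1 := act (mono_cst 1 ord0) x.

(** * Standard simplices, products, simplicial subsets *)

Definition Delta n : sset :=
  @SSet (fun m => mono m n) (fun _ _ f x => mono_comp x f)
    (fun _ x => mono_comp1 x) (fun _ _ _ g f x => mono_compA x g f).

Definition Delta_map m n (a : mono m n) : smap (Delta m) (Delta n) :=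
  @SMap (Delta m) (Delta n) (fun _ x => mono_comp a x)
    (fun _ _ f x => mono_compA a x f).

Section Product.
Variables X Y : sset.

Let pact m n (f : mono m n) (x : X n * Y n) := (act f x.1, act f x.2).

Let pact_id n (x : X n * Y n) : pact (mono_id n) x = x.
Proof. by case: x => x y; rewrite /pact !act_id. Qed.

Let pact_comp l m n (g : mono m n) (f : mono l m) (x : X n * Y n) :
  pact (mono_comp g f) x = pact f (pact g x).
Proof. by rewrite /pact !act_comp. Qed.

Definition sprod : sset := @SSet (fun n => X n * Y n)%type pact pact_id pact_comp.

Definition sfst : smap sprod X := @SMap sprod X (fun _ x => x.1) (fun _ _ _ _ => erefl).
Definition ssnd : smap sprod Y := @SMap sprod Y (fun _ x => x.2) (fun _ _ _ _ => erefl).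
End Product.
Arguments sfst {X Y}.
Arguments ssnd {X Y}.

Lemma spair_subproof X Y Z (f : smap X Y) (g : smap X Z) m n (a : mono m n) x :
  (f m (act a x), g m (act a x)) = act a ((f n x, g n x) : sprod Y Z n).
Proof. by rewrite !smap_act. Qed.

Definition spair X Y Z (f : smap X Y) (g : smap X Z) : smap X (sprod Y Z) :=
  @SMap X (sprod Y Z) (fun n x => (f n x, g n x)) (spair_subproof f g).

Definition sprod_map X Y X' Y' (f : smap X X') (g : smap Y Y') :
  smap (sprod X Y) (sprod X' Y') := spair (f \os sfst) (g \os ssnd).

Definition scst X n (k : 'I_n.+1) : smap X (Delta n) :=
  @SMap X (Delta n) (fun m _ => mono_cst m k)
    (fun _ _ f _ => esym (mono_cst_comp k f)).

Section Subset.
Variables (X : sset) (P : forall n, pred (X n)).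
Hypothesis P_act : forall m n (f : mono m n) (x : X n), P x -> P (act f x).

Let subact m n (f : mono m n) (x : {x : X n | P x}) : {x : X m | P x} :=
  exist _ (act f (val x)) (P_act f (valP x)).

Let subact_id n (x : {x : X n | P x}) : subact (mono_id n) x = x.
Proof. by apply: val_inj; rewrite /= act_id. Qed.

Let subact_comp l m n (g : mono m n) (f : mono l m) (x : {x : X n | P x}) :
  subact (mono_comp g f) x = subact f (subact g x).
Proof. by apply: val_inj; rewrite /= act_comp. Qed.

Definition ssub : sset := @SSet (fun n => {x : X n | P x}) subact subact_id subact_comp.

Definition ssub_incl : smap ssub X :=
  @SMap ssub X (fun _ x => val x) (fun _ _ _ _ => erefl).
End Subset.

(* The horn of Delta n at k: the simplices [m] -> [n] missing some vertex j <> k. *)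
Definition in_horn n (k : 'I_n.+1) m (x : Delta n m) : bool :=
  [exists j : 'I_n.+1, (j != k) && [forall i, (x : mono m n) i != j]].

Lemma in_horn_act n k l m (f : mono l m) (x : Delta n m) :
  in_horn k x -> in_horn k (act f x).
Proof.
case/existsP=> j /andP[jk /forallP xj]; apply/existsP; exists j.
by rewrite jk /=; apply/forallP=> i; rewrite mk_monoE.
Qed.

Definition horn n (k : 'I_n.+1) : sset := ssub (@in_horn_act n k).
Definition horn_incl n (k : 'I_n.+1) : smap (horn k) (Delta n) :=
  ssub_incl (@in_horn_act n k).

Section Fiber.
Variables (X : sset) (n : nat) (p : smap X (Delta n)) (k : 'I_n.+1).

Definition in_fiber m (x : X m) : bool := (p m x : mono m n) == mono_cst m k.

Lemma in_fiber_act l m (f : mono l m) (x : X m) : in_fiber x -> in_fiber (act f x).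
Proof. by rewrite /in_fiber smap_act => /eqP ->; rewrite /= mono_cst_comp. Qed.

Definition fiber : sset := ssub in_fiber_act.
Definition fiber_incl : smap fiber X := ssub_incl in_fiber_act.
End Fiber.

Section FiberMap.
Variables (X Y : sset) (n : nat) (p : smap Y (Delta n)) (f : smap X Y) (k : 'I_n.+1).

Let fm m (x : fiber (p \os f) k m) : fiber p k m := exist _ (f m (val x)) (valP x).

Let fm_act l m (a : mono l m) x : fm (act a x) = act a (fm x).
Proof. by apply: val_inj; rewrite /= smap_act. Qed.

Definition fiber_map : smap (fiber (p \os f) k) (fiber p k) := SMap fm_act.
End FiberMap.

(** * Function complexes *)

Section FunctionComplex.
Variables X Y : sset.

Let fact m n (f : mono m n) (h : smap (sprod X (Delta n)) Y) :
  smap (sprod X (Delta m)) Y := h \os sprod_map (sid X) (Delta_map f).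

Let fact_id n (h : smap (sprod X (Delta n)) Y) : fact (mono_id n) h = h.
Proof. by apply: smapP => m [x y] /=; rewrite mono_1comp. Qed.

Let fact_comp l m n (g : mono m n) (f : mono l m) (h : smap (sprod X (Delta n)) Y) :
  fact (mono_comp g f) h = fact f (fact g h).
Proof. by apply: smapP => j [x y] /=; rewrite mono_compA. Qed.

Definition Fun : sset :=
  @SSet (fun n => smap (sprod X (Delta n)) Y) fact fact_id fact_comp.

Definition Fun_vertex (f : smap X Y) : Fun 0 := f \os sfst.
End FunctionComplex.

(** * Quasicategories, inner fibrations, cartesian fibrations *)

Definition quasicategory (X : sset) :=
  forall n (k : 'I_n.+1), 0 < k < n ->
  forall u : smap (horn k) X, exists w : smap (Delta n) X, w \os horn_incl k = u.

Definition inner_fibration (X S : sset) (p : smap X S) :=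
  forall n (k : 'I_n.+1), 0 < k < n ->
  forall (u : smap (horn k) X) (b : smap (Delta n) S), p \os u = b \os horn_incl k ->
  exists w : smap (Delta n) X, w \os horn_incl k = u /\ p \os w = b.

(* u sends the edge {j, j + 1} of the horn to e; for n >= 2 the horns at 0 and n
   contain the edges {0, 1} and {n - 1, n} respectively. *)
Definition horn_edge_at n (k : 'I_n.+1) (X : sset) (u : smap (horn k) X) (j : nat)
    (e : X 1) :=
  exists2 x : horn k 1,
    (forall i, (val x : mono 1 n) i = j + i :> nat) & u 1 x = e.

Definition cartesian_edge (X S : sset) (p : smap X S) (e : X 1) :=
  forall n, 2 <= n ->
  forall (u : smap (horn (@ord_max n)) X) (b : smap (Delta n) S),
  p \os u = b \os horn_incl ord_max -> horn_edge_at u n.-1 e ->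
  exists w : smap (Delta n) X, w \os horn_incl ord_max = u /\ p \os w = b.

Definition cocartesian_edge (X S : sset) (p : smap X S) (e : X 1) :=
  forall n, 2 <= n ->
  forall (u : smap (horn (@ord0 n)) X) (b : smap (Delta n) S),
  p \os u = b \os horn_incl ord0 -> horn_edge_at u 0 e ->
  exists w : smap (Delta n) X, w \os horn_incl ord0 = u /\ p \os w = b.

Definition cartesian_fibration (X S : sset) (p : smap X S) :=
  inner_fibration p /\
  forall (f : S 1) (y : X 0), p 0 y = target f ->
  exists e : X 1, [/\ p 1 e = f, target e = y & cartesian_edge p e].

(** * Equivalences *)

Definition is_composite (X : sset) (f g h : X 1) :=
  exists t : X 2, [/\ act (coface (inord 2)) t = f,
                      act (coface (inord 0)) t = g &
                      act (coface (inord 1)) t = h].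

(* In a quasicategory: f is invertible in the homotopy category. *)
Definition is_equivalence (X : sset) (f : X 1) :=
  exists g : X 1, is_composite f g (degen (source f)) /\
                  is_composite g f (degen (target f)).

Definition equivalent_vertices (X : sset) (x y : X 0) :=
  exists f : X 1, [/\ source f = x, target f = y & is_equivalence f].

Definition equivalent_maps (X Y : sset) (f g : smap X Y) :=
  equivalent_vertices (Fun_vertex f) (Fun_vertex g).

(** * Adjunct maps *)

Notation I0 := (@ord0 1).
Notation I1 := (@ord_max 1).

Definition cyl (X : sset) : sset := sprod X (Delta 1).
Definition cyl_end (X : sset) (k : 'I_2) : smap X (cyl X) := spair (sid X) (scst X k).
(* The edge {x} * Delta^1. *)
Definition cyl_edge (X : sset) (x : X 0) : cyl X 1 := (degen x, mono_id 1).

Section Adjunct.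
Variables (C D M : sset) (p : smap M (Delta 1)).
(* The chosen identifications of C and D with the fibers of p. *)
Variables (hC : smap C (fiber p I0)) (hD : smap D (fiber p I1)).

Definition inC : smap C M := fiber_incl p I0 \os hC.
Definition inD : smap D M := fiber_incl p I1 \os hD.

Record classifies (g : smap D C) (v : smap (cyl D) M) : Prop := Classifies {
  classifies_C : is_siso hC;
  classifies_D : is_siso hD;
  classifies_over : p \os v = ssnd;
  classifies_1 : v \os cyl_end D I1 = inD;
  classifies_0 : v \os cyl_end D I0 = inC \os g;
  classifies_cart : forall d : D 0, cartesian_edge p (v 1 (cyl_edge d)) }.

Definition left_adjoint_at (c : C 0) :=
  exists e : M 1, [/\ p 1 e = mono_id 1, source e = inC 0 c & cocartesian_edge p e].

Definition adjunct (v : smap (cyl D) M) (K : sset) (s : smap K (Delta 1))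
    (a : smap K C) (ta : smap K D) :=
  exists A : smap (cyl K) M,
    p \os A = ssnd /\
    [/\ A \os cyl_end K I0 = inC \os a,
        A \os cyl_end K I1 = inD \os ta,
        forall k : fiber s I0 0, cocartesian_edge p (A 1 (cyl_edge (val k))) &
        A \os sprod_map (fiber_incl s I1) (sid (Delta 1)) =
          v \os sprod_map ta (sid (Delta 1)) \os
            sprod_map (fiber_incl s I1) (sid (Delta 1))].
End Adjunct.

(* Main.v *)
Require Import Defs.
From mathcomp Require Import all_boot.
From mathcomp Require Import boolp classical_sets zify.
Set Implicit Arguments.
Unset Strict Implicit.
Unset Printing Implicit Defensive.

(** Given an adjunct on K', the required map A on K x Delta^1 is prescribed on
    K' x Delta^1 and on K x {0}. A simplex x of K outside K' has its initial vertex
    in K_0, since K' contains K_1. If x has dimension n and its faces are already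
    treated, the n + 1 cells 00 ... k0 k1 ... n1 of x x Delta^1 are attached for
    k = n, ..., 0 along horns at k. These are inner for k > 0, and for k = 0 their
    initial edge is the cocartesian edge over the initial vertex of x; for n = 0 the
    only cell is an edge, filled by a chosen cocartesian lift.
    For uniqueness, let J be the contractible groupoid on two objects. Two solutions
    A1, A2 agree over K_1, so they define a map on (K_1 x J u K x {0, 1}) x Delta^1;
    extending it to K x J x Delta^1 by the same argument gives a map K x J -> D, that
    is, an equivalence between the two lifts in Fun(K, D). *)

(** * Monotone maps *)

Lemma mono_compE l m n (g : mono m n) (f : mono l m) a : mono_comp g f a = g (f a).
Proof. exact: mk_monoE. Qed.

Lemma mono_cstE m n (k : 'I_n.+1) a : mono_cst m k a = k.
Proof. exact: mk_monoE. Qed.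

Lemma I2_cases (a : 'I_2) : a = I0 \/ a = I1.
Proof. by case: a => [[|[|//]] ?]; [left|right]; apply: val_inj. Qed.

Lemma mono_cst01 m : mono_cst m I1 <> mono_cst m I0.
Proof. by move/(congr1 (fun u : mono m 1 => u ord0 : nat)); rewrite !mk_monoE. Qed.

Definition onto m n (f : mono m n) := forall j, exists i, f i = j.

Lemma onto_or_misses m n (f : mono m n) :
  onto f \/ exists j, forall i, f i != j.
Proof.
case: (pselect (exists j, forall i, f i != j)) => [|nf]; [by right|left=> j].
apply: contrapT => nj; apply: nf; exists j => i.
by apply/eqP => fi; apply: nj; exists i.
Qed.

Lemma not_onto m n (f : mono m n) j : (forall i, f i != j) -> ~ onto f.
Proof. by move=> fj /(_ j)[i /eqP]; rewrite (negPf (fj i)). Qed.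

(** Any choice of preimages is monotone: [d l < d k] with [k <= l] forces [k = l] after applying
    [f]. So the preimage of [f i] may be taken to be [i]. *)
Lemma mono_section_through m n (f : mono m n) (i : 'I_m.+1) : onto f ->
  exists2 d : mono n m, mono_comp f d = mono_id n & d (f i) = i.
Proof.
move=> fs; pose d k := if k == f i then i else odflt ord0 [pick j | f j == k].
have fd k : f (d k) = k.
  rewrite /d; case: eqP => [->//|_]; case: pickP => [j /eqP//|nj].
  by have [j /eqP] := fs k; rewrite nj.
have dP (k l : 'I_n.+1) : k <= l -> d k <= d l.
  move=> kl; rewrite leqNgt; apply/negP => lt.
  have := mono_le f (ltnW lt); rewrite !fd => lk.
  have ekl : k = l by apply/val_inj/eqP; rewrite eqn_leq kl.
  by rewrite ekl ltnn in lt.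
exists (mk_mono dP); last by rewrite mk_monoE /d eqxx.
by apply: monoP => k; rewrite !mk_monoE fd.
Qed.

Lemma strict_mono_ge n (h : 'I_n.+1 -> 'I_n.+1) :
  (forall i j : 'I_n.+1, i < j -> h i < h j) -> forall i : 'I_n.+1, i <= h i.
Proof.
move=> hP [k kn]; elim: k kn => // k IH kn /=.
have kn' : k < n.+1 by lia.
by apply: leq_ltn_trans (IH kn') (hP (Ordinal kn') (Ordinal kn) _).
Qed.

(** Counting makes [h] injective, hence strictly monotone, and so is its section [e]. Strictly
    monotone endomaps never decrease a point, so [k <= e k <= h (e k) = k]. *)
Lemma onto_endo_id n (h : mono n n) : onto h -> h = mono_id n.
Proof.
move=> hs; have inj_h : injective h.
  have hb : #|codom h| = #|'I_n.+1|.
    by apply: eq_card => j; have [i <-] := hs j; rewrite codom_f.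
  by apply/injectiveP; rewrite /injectiveb /dinjectiveb; apply/card_uniqP; rewrite hb size_image.
have hlt (i j : 'I_n.+1) : i < j -> h i < h j.
  move=> ij; rewrite ltn_neqAle mono_le 1?ltnW// andbT.
  by apply: contraTneq ij => /val_inj/inj_h ->; rewrite ltnn.
have [e he _] := mono_section_through ord0 hs.
have heE k : h (e k) = k by have := congr1 (fun u : mono n n => u k) he; rewrite !mk_monoE.
have elt (i j : 'I_n.+1) : i < j -> e i < e j.
  move=> ij; rewrite ltnNge; apply/negP => /(mono_le h); rewrite !heE; lia.
apply: monoP => k; rewrite mk_monoE; apply/val_inj => /=.
have ek : e k = k.
  apply/val_inj/eqP => /=; rewrite eqn_leq (strict_mono_ge elt) andbT.
  by rewrite -{2}(heE k) (strict_mono_ge hlt).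
by rewrite -{1}ek heE.
Qed.

Lemma codegen_subproof n (j : nat) (a b : 'I_n.+2) : a <= b ->
  (inord (minn n (a - (j < a))) : 'I_n.+1) <= (inord (minn n (b - (j < b))) : 'I_n.+1).
Proof. move=> ab; rewrite !inordK ?ltnS ?geq_minl//; lia. Qed.

(** The degeneracy taking the value [j] twice. The cap at [n] matters only for [j > n]; it makes
    [codegen n j] left inverse to [coface j] for [j = n + 1] too. *)
Definition codegen n (j : nat) : mono n.+1 n := mk_mono (@codegen_subproof n j).

Lemma codegenE n (j : nat) (a : 'I_n.+2) :
  codegen n j a = minn n (a - (j < a)) :> nat.
Proof. by rewrite mk_monoE inordK // ltnS geq_minl. Qed.

Lemma missing_factor m n (f : mono m n.+1) (j : 'I_n.+2) : (forall i, f i != j) ->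
  f = mono_comp (coface j) (mono_comp (codegen n j) f).
Proof.
move=> fj; apply: monoP => i; rewrite !mk_monoE; apply/val_inj => /=.
rewrite -[in RHS](mk_monoE (@codegen_subproof n j)) -/(codegen n j) codegenE /bump.
have /eqP := fj i; have := ltn_ord (f i); have := ltn_ord j.
move=> ? ? ne; have ne' : f i <> j :> nat by move/val_inj.
lia.
Qed.

(** * Eilenberg-Zilber *)

(* The hypotheses hold for a simplex x of minimal dimension outside L, so no
   decomposition into nondegenerate simplices is needed. *)
Section EilenbergZilber.
Variables (X : sset) (L : forall m, X m -> Prop) (n : nat) (x : X n).
Hypothesis L_act : forall l m (f : mono l m) (y : X m), L y -> L (act f y).
Hypothesis nLx : ~ L x.
Hypothesis L_face : forall m (f : mono m n), ~ onto f -> L (act f x).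

Lemma EZ_onto m (f : mono m n) : ~ L (act f x) -> onto f.
Proof. by move=> nL; apply: contrapT => /L_face. Qed.

Lemma EZ_not_onto m (f : mono m n) : L (act f x) -> ~ onto f.
Proof.
move=> Lf fs; have [d fd _] := mono_section_through ord0 fs.
by apply: nLx; rewrite -(act_id x) -fd act_comp; apply: L_act.
Qed.

(** For a section [d] of [f] through [i], the composite of [f'] and [d] fixes [x], so it is onto,
    hence the identity; evaluating at [f i] gives [f' i = f i]. *)
Lemma EZ_inj m (f f' : mono m n) : onto f -> act f x = act f' x -> f = f'.
Proof.
move=> fs ff'; apply: monoP => i.
have [d fd di] := mono_section_through i fs.
have e : act (mono_comp f' d) x = x by rewrite act_comp -ff' -act_comp fd act_id.
have /onto_endo_id f'd : onto (mono_comp f' d) by apply: EZ_onto; rewrite e.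
by have := congr1 (fun u : mono n n => u (f i)) f'd; rewrite !mk_monoE di.
Qed.
End EilenbergZilber.

(** * Partial simplicial maps *)

(** Partial maps are encoded by graphs, which makes attaching a cell a disjunction and the union of
    a chain an existential. *)
Definition srel (X Y : sset) := forall m, X m -> Y m -> Prop.

Section Srel.
Variables X Y : sset.
Implicit Types G : srel X Y.

Definition sdom G m (x : X m) := exists y, G m x y.

Definition partial_smap G :=
  (forall l m (f : mono l m) x y, G m x y -> G l (act f x) (act f y)) /\
  (forall m x y y', G m x y -> G m x y' -> y = y').

Definition attach G N (t : X N) (e : Y N) : srel X Y := fun m x y =>
  G m x y \/ exists f : mono m N, x = act f t /\ y = act f e.

Lemma sdom_act G l m (f : mono l m) x : partial_smap G -> sdom G x -> sdom G (act f x).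
Proof. by move=> [Ga _] [y /(Ga _ _ f)]; exists (act f y). Qed.

(** Ambiguity could arise in two ways: [e] could disagree with [G] on faces already treated, or a
    new face of [t] could be given by two monotone maps. The hypotheses exclude both. *)
Lemma partial_attach G N (t : X N) (e : Y N) : partial_smap G ->
  (forall m (f : mono m N), sdom G (act f t) -> G m (act f t) (act f e)) ->
  (forall m (f f' : mono m N), ~ sdom G (act f t) -> act f t = act f' t -> f = f') ->
  partial_smap (attach G t e).
Proof.
move=> [Ga Gf] Gt tinj; split=> [l m f x y|m x y y'].
  case=> [/Ga Gxy|[h [-> ->]]]; first by left.
  by right; exists (mono_comp h f); rewrite !act_comp.
have cell f y0 : G m (act f t) y0 -> act f e = y0.
  by move=> h; apply: (Gf _ _ _ _ (Gt _ _ _) h); exists y0.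
case=> [Gy|[f [-> ->]]] [Gy'|[f' []]].
- exact: Gf Gy Gy'.
- by move=> ex ->; rewrite ex in Gy; rewrite (cell _ _ Gy).
- exact: cell.
- move=> ff' ->; have [[y0 Gy0]|nG] := pselect (sdom G (act f t)).
    by rewrite (cell _ _ Gy0); rewrite ff' in Gy0; rewrite (cell _ _ Gy0).
  by rewrite (tinj _ _ _ nG ff').
Qed.

Lemma smap_of_graph G : partial_smap G -> (forall m (x : X m), sdom G x) ->
  exists F : smap X Y, forall m x, G m x (F m x).
Proof.
move=> [Ga Gf] Gt; pose F m x := sval (cid (Gt m x)).
have FP m x : G m x (F m x) by rewrite /F; case: cid.
have Fact m n (f : mono m n) x : F m (act f x) = act f (F n x).
  exact: Gf (FP _ _) (Ga _ _ _ _ _ (FP _ _)).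
by exists (SMap Fact).
Qed.
End Srel.

Lemma yoneda_subproof (X : sset) N (e : X N) l m (f : mono l m) (x : mono m N) :
  act (mono_comp x f) e = act f (act x e).
Proof. exact: act_comp. Qed.

Definition yoneda (X : sset) N (e : X N) : smap (Delta N) X :=
  @SMap (Delta N) X (fun _ x => act x e) (yoneda_subproof e).

Lemma smap_Delta (X : sset) N (w : smap (Delta N) X) m (f : mono m N) :
  w m f = act f (w N (mono_id N)).
Proof. by rewrite -smap_act /= mono_1comp. Qed.

(** * Extending maps out of cylinders *)

Section Extension.
Variables (M : sset) (p : smap M (Delta 1)) (K K' : sset).
Variables (s : smap K (Delta 1)) (i : smap K' K).
Variables (b : smap K M) (A' : smap (cyl K') M).
Hypothesis inner_p : inner_fibration p.
Hypothesis i_inj : is_smono i.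
Hypothesis i_fiber1 : forall n (x : K n), s n x = mono_cst n I1 -> exists x', i n x' = x.
Hypothesis b_over : p \os b = scst K I0.
Hypothesis A'_over : p \os A' = ssnd.
Hypothesis A'_0 : A' \os cyl_end K' I0 = b \os i.
Hypothesis A'_cocart : forall k : K' 0, s 0 (i 0 k) = mono_cst 0 I0 ->
  cocartesian_edge p (A' 1 (cyl_edge k)).
Hypothesis cocart_lift : forall k : K 0, s 0 k = mono_cst 0 I0 ->
  exists e, [/\ p 1 e = mono_id 1, source e = b 0 k & cocartesian_edge p e].

Implicit Types G H : srel (cyl K) M.

Definition cocart_on0 G := forall (k : K 0) y, s 0 k = mono_cst 0 I0 ->
  G 1 (cyl_edge k) y -> cocartesian_edge p y.

Definition good G := [/\ partial_smap G,
  forall m x y, G m x y -> p m y = x.2,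
  forall m x, G m (x, mono_cst m I0) (b m x),
  forall m x e, G m (i m x, e) (A' m (x, e)) &
  cocart_on0 G].

Definition full G m (x : K m) := sdom G ((x, mono_cst m I1) : cyl K m).

(** For good [G] this gives the domain the form K x {0} together with L x Delta^1, where L consists
    of the full simplices. *)
Definition saturated G := forall m (x : K m) (e e' : mono m 1), e <> mono_cst m I0 ->
  sdom G ((x, e) : cyl K m) -> sdom G ((x, e') : cyl K m).

Lemma full_act G l m (f : mono l m) (x : K m) : partial_smap G -> full G x -> full G (act f x).
Proof. by move=> Gp /(sdom_act f Gp); rewrite /= mono_cst_comp. Qed.

Lemma saturated_full G m (x : K m) e : saturated G -> full G x -> sdom G ((x, e) : cyl K m).
Proof. by move=> Gs; apply: Gs; apply: mono_cst01. Qed.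

Definition base_rel : srel (cyl K) M := fun m x y =>
  (x.2 = mono_cst m I0 /\ y = b m x.1) \/ (exists2 x', i m x' = x.1 & y = A' m (x', x.2)).

Lemma A'_cst0 m x : A' m (x, mono_cst m I0) = b m (i m x).
Proof. exact: (congr1 (fun u : smap _ _ => u m x) A'_0). Qed.

Lemma p_A' m x : p m (A' m x) = x.2.
Proof. exact: (congr1 (fun u : smap _ _ => u m x) A'_over). Qed.

Lemma p_b m x : p m (b m x) = mono_cst m I0.
Proof. exact: (congr1 (fun u : smap _ _ => u m x) b_over). Qed.

(** The edge [x] and the degeneracy of its source have the same image under the injective [i]. This
    brings edges over [cyl_edge k] within reach of [A'_cocart]. *)
Lemma degen_inj (k : K 0) x : i 1 x = degen k -> exists2 k', i 0 k' = k & x = degen k'.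
Proof.
move=> xk; have ek : i 0 (source x) = k.
  rewrite /source /vertex smap_act xk /degen -act_comp -[RHS]act_id.
  by congr (act _ k); apply: monoP => j; rewrite !mk_monoE (ord1 j).
by exists (source x) => //; apply: i_inj; rewrite xk smap_act ek.
Qed.

(** The two clauses of [base_rel] overlap only over K' x {0}, where [A'_0] reconciles them. *)
Lemma good_base : good base_rel.
Proof.
split=> [|m [x e] y|m x|m x e|k y s0].
- split=> [l m f [x e] y|m [x e] y y'].
    case=> /= [[-> ->]|[x' <- ->]]; first by left; rewrite /= mono_cst_comp smap_act.
    by right; exists (act f x'); rewrite /= -!smap_act.
  case=> /= [[-> ->]|[x' <- ->]] [[/= e0 ->]|[x'' /= ix ->]] //.
  - by rewrite A'_cst0 ix.
  - by rewrite e0 A'_cst0.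
  - by rewrite (i_inj ix).
- by case=> /= [[-> ->]|[x' _ ->]]; rewrite ?p_b ?p_A'.
- by left.
- by right; exists x.
- case=> /= [[/(congr1 (fun u : mono 1 1 => u I1 : nat))]|]; first by rewrite !mk_monoE.
  by move=> [x /degen_inj[k' ik ->] ->]; apply: A'_cocart; rewrite ik.
Qed.

Lemma saturated_base : saturated base_rel.
Proof.
move=> m x e e' ne0 [y [[//]|/= [x' ix _]]].
by exists (A' m (x', e')); right; exists x'.
Qed.

Lemma good_base_sub G m x y : good G -> base_rel (m := m) x y -> G m x y.
Proof.
case=> _ _ Gb GA' _; case: x => x e [/= [-> ->]|/= [x' <- ->]]; [exact: Gb|exact: GA'].
Qed.

Lemma prism_e_subproof n k (a c : 'I_n.+1) : a <= c ->
  (inord (k < a) : 'I_2) <= (inord (k < c) : 'I_2).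
Proof. move=> ac; rewrite !inordK; lia. Qed.

Definition prism_e n k : mono n 1 := mk_mono (@prism_e_subproof n k).

Lemma prism_eE n k a : prism_e n k a = (k < a) :> nat.
Proof. rewrite mk_monoE inordK; lia. Qed.

(** * Attaching the prism over a single simplex *)

Section Prism.
Variables (G : srel (cyl K) M) (n : nat) (x : K n).
Hypothesis G_good : good G.
Hypothesis G_sat : saturated G.
Hypothesis x_nfull : ~ full G x.
Hypothesis x_face : forall m (f : mono m n), ~ onto f -> full G (act f x).
Hypothesis x_0 : s 0 (vertex ord0 x) = mono_cst 0 I0.

Let G_partial : partial_smap G. Proof. by case: G_good. Qed.

Let G_cst0 m (y : K m) : sdom G ((y, mono_cst m I0) : cyl K m).
Proof. by exists (b m y); case: G_good. Qed.

(* The cell 00 ... k0 k1 ... n1 of [x * Delta^1]. *)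
Definition prism_cell k : cyl K n.+1 := (act (codegen n k) x, prism_e n.+1 k).

(* The simplices of [x * Delta^1] lying in a cell [prism_cell j] with [k <= j]. *)
Definition in_cells k m (y : cyl K m) := exists2 f : mono m n, y.1 = act f x &
  exists2 j, k <= j <= n & forall a, if (y.2 : mono m 1) a == I0 then f a <= j else j <= f a.

(** By saturation, a face off K x {0} is in the domain only if its K-coordinate is full, and no
    surjection carries [x] to a full simplex. *)
Lemma sG_cell k m (g : mono m n.+1) : sdom G (act g (prism_cell k)) <->
  (~ onto (mono_comp (codegen n k) g) \/ mono_comp (prism_e n.+1 k) g = mono_cst m I0).
Proof.
rewrite /prism_cell /= -act_comp; split=> [dg|].
  have [|ne0] := pselect (mono_comp (prism_e n.+1 k) g = mono_cst m I0); first by right.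
  left; apply: (EZ_not_onto (L := @full G) _ x_nfull) => [*|]; first exact: full_act.
  exact: G_sat ne0 dg.
case=> [/x_face/saturated_full|->]; last exact: G_cst0.
exact.
Qed.

Lemma EZ_x m (f f' : mono m n) : onto f -> act f x = act f' x -> f = f'.
Proof. exact: (EZ_inj x_nfull x_face). Qed.

Section Step.
Variables (k : 'I_n.+2) (H : srel (cyl K) M).
Hypothesis k_le : k <= n.
Hypothesis H_good : good H.
Hypothesis dom_H : forall m (y : cyl K m), sdom H y <-> sdom G y \/ in_cells k.+1 y.

Let t := prism_cell k.

(** A face missing some [j] other than [k] and [k + 1] projects to a proper face of [x]. One missing
    [k + 1] lies in the cell of index [k + 1], or in K x {0} when [k = n]. *)
Lemma in_horn_dom m (g : mono m n.+1) : in_horn k g -> sdom H (act g t).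
Proof.
case/existsP=> j /andP[jk /forallP gj]; apply/dom_H.
have jk' : j <> k :> nat by move/val_inj/eqP; rewrite (negPf jk).
have gj' a : g a <> j :> nat by move/val_inj/eqP; rewrite (negPf (gj a)).
have j_lt := ltn_ord j.
have [jk1|jk1] := eqVneq (j : nat) k.+1.
  have [kn|kn] := eqVneq (k : nat) n.
    left; apply/sG_cell; right; apply: monoP => a; apply: val_inj.
    rewrite /= mono_compE prism_eE mono_cstE /=.
    have := gj' a; have := ltn_ord (g a); lia.
  right; exists (mono_comp (codegen n k) g); first by rewrite /= act_comp.
  exists k.+1; first lia.
  move=> a; rewrite -(inj_eq val_inj) /= !mono_compE codegenE prism_eE.
  have := gj' a; have := ltn_ord (g a); case: ifP; lia.
left; apply/sG_cell; left.
have jn : j - (k < j) < n.+1 by lia.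
apply: (@not_onto _ _ _ (Ordinal jn)) => a; apply/eqP => /(congr1 val) /=.
rewrite mono_compE codegenE; have := gj' a; have := ltn_ord (g a); lia.
Qed.

(** A simplex outside the horn hits every vertex except perhaps [k]. So it stays onto after
    [codegen], and it hits vertex [k + 1], which is k1 and lies in no cell of index above [k]. *)
Lemma dom_in_horn m (g : mono m n.+1) : sdom H (act g t) -> in_horn k g.
Proof.
move=> Hg; apply: contrapT => nh.
have hit (j : 'I_n.+2) : j != k -> exists a, g a = j.
  move=> jk; apply: contrapT => na; apply: nh; apply/existsP; exists j; rewrite jk.
  by apply/forallP=> a; apply/eqP => ga; apply: na; exists a.
have fs : onto (mono_comp (codegen n k) g).
  move=> j; have jn := ltn_ord j.
  have j'n : j + (k <= j) < n.+2 by lia.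
  have [|a ga] := hit (Ordinal j'n); first by rewrite -(inj_eq val_inj) /=; lia.
  by exists a; apply: val_inj; rewrite /= mono_compE codegenE ga /=; lia.
have [a ga] : exists a, g a = k.+1 :> nat.
  have k1 : k.+1 < n.+2 by lia.
  have [|a ga] := hit (Ordinal k1); first by rewrite -(inj_eq val_inj) /=; lia.
  by exists a; rewrite ga.
case/dom_H: Hg => [/sG_cell[//|/(congr1 (fun u : mono m 1 => u a : nat))]|].
  by rewrite mono_compE prism_eE mono_cstE /= ga /=; lia.
case=> f /= ; rewrite -act_comp => /(EZ_x fs) <- [j kj /(_ a)].
rewrite -(inj_eq val_inj) /= !mono_compE codegenE prism_eE ga /=.
by case: ifP; lia.
Qed.

Let H_partial : partial_smap H. Proof. by case: H_good. Qed.

Lemma prism_horn : exists u : smap (horn k) M, forall m y, @H m (act (val y) t) (u m y).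
Proof.
have [Ha Hf] := H_partial.
apply: (@smap_of_graph (horn k) M (fun m y z => @H m (act (val y) t) z)).
  split=> [l m f y z Hyz|m y z z']; last exact: Hf.
  by rewrite [val _]/(mono_comp (val y) f) act_comp; apply: Ha.
by move=> m y; apply: in_horn_dom (valP y).
Qed.

Definition prism_filler (w : smap (Delta n.+1) M) :=
  [/\ p \os w = Delta_map (prism_e n.+1 k),
    forall m (g : mono m n.+1), in_horn k g -> @H m (act g t) (w m g) &
    forall (v : K 0) (g : mono 1 n.+1), s 0 v = mono_cst 0 I0 ->
      act g t = cyl_edge v -> cocartesian_edge p (w 1 g)].

Lemma prism_filler_edge : n = 0 -> exists w, prism_filler w.
Proof.
move=> n0; have [e [pe se e_cocart]] := cocart_lift x_0.
(* Here [prism_e] is the identity, as [n = k = 0]; composing with it spares a transport of [e] along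
   [n = 0]. *)
exists (yoneda e \os Delta_map (prism_e n.+1 k)); split=> [|m g gh|v g s0 gt].
- by apply: smapP => m g /=; rewrite smap_act pe /= mono_1comp.
- have [_ _ Hb _ _] := H_good.
  have e0 : mono_comp (prism_e n.+1 k) g = mono_cst m I0.
    apply: monoP => a; apply: val_inj; rewrite /= mono_compE prism_eE mono_cstE /=.
    case/existsP: gh => j /andP[jk /forallP/(_ a)].
    move: jk; rewrite -!(inj_eq val_inj) /=.
    have := ltn_ord j; have := ltn_ord (g a); lia.
  rewrite /= e0 -act_comp.
  rewrite (_ : mono_comp (codegen n k) g = mono_comp (mono_cst 0 ord0) (mono_cst m ord0)).
    rewrite (_ : mono_cst m I0 = mono_comp (mono_cst 0 I0) (mono_cst m ord0)); last first.
      by rewrite mono_cst_comp.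
    rewrite !act_comp -/(vertex I0 e) -/(source e) se -smap_act -/(vertex ord0 x).
    by rewrite mono_cst_comp; apply: Hb.
  apply: monoP => a; apply: val_inj.
  have := ltn_ord (mono_comp (codegen n k) g a).
  have := ltn_ord (mono_comp (mono_cst 0 ord0) (mono_cst m ord0 : mono m 0) a : 'I_n.+1).
  rewrite /=; lia.
- by move/(congr1 snd): gt => /= gt; rewrite gt act_id.
Qed.

Lemma prism_filler_pos : 0 < n -> exists w, prism_filler w.
Proof.
move=> n0; have [u Hu] := prism_horn; have [_ H_over _ _ Hc] := H_good.
have pu : p \os u = Delta_map (prism_e n.+1 k) \os horn_incl k.
  by apply: smapP => m y; apply: (H_over _ _ _ (Hu m y)).
have [w [wu pw]] : exists w, w \os horn_incl k = u /\ p \os w = Delta_map (prism_e n.+1 k).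
  have [k0|k0] := eqVneq k ord0; last first.
    by apply: inner_p pu; move: k0; rewrite -(inj_eq val_inj) /=; lia.
  (* For [k = 0], the edge [q] from 0 to 1 lies in the horn because it misses the vertex
     [n + 1 >= 2]; it maps to the cylinder edge over the initial vertex of [x]. *)
  have edgeP (a c : 'I_2) : a <= c -> (inord a : 'I_n.+2) <= (inord c : 'I_n.+2).
    by move=> ac; rewrite !inordK //; have := ltn_ord a; have := ltn_ord c; lia.
  pose q : mono 1 n.+1 := mk_mono edgeP.
  have qE a : q a = a :> nat by rewrite mk_monoE inordK //; have := ltn_ord a; lia.
  have qh : in_horn k (q : Delta n.+1 1).
    apply/existsP; exists ord_max; rewrite k0 -(inj_eq val_inj) /=; apply/forallP => a.
    by rewrite -(inj_eq val_inj) /= qE; have := ltn_ord a; lia.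
  have ue : horn_edge_at u 0 (u 1 (exist _ q qh : horn k 1)).
    by exists (exist _ q qh : horn k 1) => // a; rewrite /= qE.
  have ec : cocartesian_edge p (u 1 (exist _ q qh : horn k 1)).
    apply: (Hc _ _ x_0); have := Hu 1 (exist _ q qh : horn k 1); congr (@H 1 _ _).
    rewrite /= /cyl_edge /degen /vertex -!act_comp; congr (act _ x, _).
      apply: monoP => a; apply: val_inj.
      rewrite /= !mono_compE !mono_cstE codegenE qE k0 /=; have := ltn_ord a; lia.
    apply: monoP => a; apply: val_inj.
    rewrite /= mono_compE prism_eE qE mk_monoE k0 /=; have := ltn_ord a; lia.
  (* The edge and [u] are generalized so that [k], on which their types depend, can be replaced by
     [ord0]. *)
  move: (u 1 _) ue ec => e; move: u {Hu} pu; rewrite k0 => u pu ue ec.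
  exact: ec pu ue.
have Hw m (g : mono m n.+1) : in_horn k g -> @H m (act g t) (w m g).
  move=> gh; have := Hu m (exist _ g gh : horn k m).
  by rewrite -wu.
(* Since [n > 0], the vertex [v] is a proper face of [x], so its cylinder edge is already in the
   domain of [H], which makes it cocartesian. *)
exists w; split=> // v g s0 gt; apply: (Hc _ _ s0); rewrite -gt.
apply/Hw/dom_in_horn/dom_H; left; rewrite gt.
apply: saturated_full => //; apply: full_act => //.
have -> : v = act (mono_comp (codegen n k) (mono_comp g (mono_cst 0 ord0))) x.
  rewrite mono_compA !act_comp; move/(congr1 fst): gt => /= ->.
  rewrite /degen -act_comp -[LHS]act_id; congr (act _ v).
  by apply: monoP => j; rewrite !mk_monoE (ord1 j).
apply: x_face => f_onto.
have [a ea] := f_onto ord0; have [c ec] := f_onto ord_max.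
move: ec; rewrite (ord1 c) -(ord1 a) ea => /(congr1 val) /=; lia.
Qed.

(** [in_horn_dom] and [dom_in_horn] identify the part of [t] already treated with the horn at [k],
    so a filler of that horn can be attached. *)
Lemma prism_step : exists H', [/\ good H', forall m y z, @H m y z -> @H' m y z &
  forall m (y : cyl K m), sdom H' y <-> sdom G y \/ in_cells k y].
Proof.
have [w [pw wh wc]] : exists w, prism_filler w.
  by have [/prism_filler_edge|/prism_filler_pos] := posnP n.
have [_ H_over Hb HA' Hc] := H_good.
have wE m (g : mono m n.+1) : w m g = act g (w n.+1 (mono_id n.+1)) by exact: smap_Delta.
exists (attach H t (w n.+1 (mono_id n.+1))); split; first split.
- apply: partial_attach => // [m f ft|m f f' nd ff'].
    by rewrite -wE; apply/wh/dom_in_horn.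
  (* On a new face, Eilenberg-Zilber recovers the composite with [codegen]; this merges only [k] and
     [k + 1], which [prism_e] separates. *)
  have f_onto : onto (mono_comp (codegen n k) f).
    apply: contrapT => nf; apply: nd; apply/dom_H; left; apply/sG_cell; by left.
  have := congr1 fst ff'; rewrite /= -!act_comp => /(EZ_x f_onto) fe.
  have := congr1 snd ff' => /= ee; apply: monoP => a; apply: val_inj => /=.
  have := congr1 (fun u : mono m n => u a : nat) fe.
  have := congr1 (fun u : mono m 1 => u a : nat) ee.
  rewrite !mono_compE !codegenE !prism_eE.
  by have := ltn_ord (f a); have := ltn_ord (f' a); lia.
- move=> m y z [/H_over//|[f [-> ->]]]; rewrite -wE.
  exact: (congr1 (fun u : smap (Delta n.+1) (Delta 1) => u m f) pw).
- by move=> m y; left.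
- by move=> m y e; left.
- by move=> v y s0 [/(Hc _ _ s0)//|[f [/esym ft ->]]]; rewrite -wE; apply: wc ft.
- by left.
move=> m y; split=> [[z [Hz|[f [-> _]]]]|].
- have /dom_H[|[f yf [j kj jP]]] : sdom H y by exists z.
    by left.
  by right; exists f => //; exists j => //; lia.
- right; exists (mono_comp (codegen n k) f); first by rewrite /= act_comp.
  exists k; first lia.
  move=> a; rewrite -(inj_eq val_inj) /= !mono_compE codegenE prism_eE.
  by have := ltn_ord (f a); case: ifP; lia.
case=> [Gy|[f yf [j kj jP]]].
  by have /dom_H[z Hz] : sdom G y \/ in_cells k.+1 y; [left|exists z; left].
have [jk|jk] := eqVneq j k; last first.
  have /dom_H[z Hz] : sdom G y \/ in_cells k.+1 y; last by exists z; left.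
  by right; exists f => //; exists j => //; lia.
case: y yf jP => [y e] /= yf jP.
(* For [j = k] the simplex is a face of [t]: vertices at level 0 keep their index and those at level
   1 are shifted by one. *)
have hP (a c : 'I_m.+1) : a <= c -> (inord (f a + e a) : 'I_n.+2) <= (inord (f c + e c) : 'I_n.+2).
  move=> ac; have := mono_le f ac; have := mono_le e ac.
  have := ltn_ord (f a); have := ltn_ord (f c); have := ltn_ord (e a); have := ltn_ord (e c).
  by move=> *; rewrite !inordK; lia.
pose h : mono m n.+1 := mk_mono hP.
have hE a : h a = f a + e a :> nat.
  by rewrite mk_monoE inordK //; have := ltn_ord (f a); have := ltn_ord (e a); lia.
exists (act h (w n.+1 (mono_id n.+1))); right; exists h; split=> //.
rewrite /= -act_comp yf; congr (act _ x, _).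
  apply: monoP => a; apply: val_inj; rewrite /= mono_compE codegenE hE.
  move: (jP a); rewrite -(inj_eq val_inj) /=.
  by have := ltn_ord (f a); have := ltn_ord (e a); case: ifP; lia.
apply: monoP => a; apply: val_inj; rewrite /= mono_compE prism_eE hE.
move: (jP a); rewrite -(inj_eq val_inj) /=.
by have := ltn_ord (f a); have := ltn_ord (e a); case: ifP; lia.
Qed.

End Step.
(** Descending induction on the index: after [d] steps the cells of index at least [n + 1 - d] are
    attached, hence none for [d = 0]. *)
Lemma prism_steps d : d <= n.+1 -> exists H, [/\ good H, forall m y z, @G m y z -> @H m y z &
  forall m (y : cyl K m), sdom H y <-> sdom G y \/ in_cells (n.+1 - d) y].
Proof.
elim: d => [|d IH] dn.
  exists G; split=> // m y; split=> [|[//|[f _ [j]]]]; first by left.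
  by move=> jn; exfalso; lia.
have [|H [Hg GH dom_H]] := IH; first lia.
have kn : n - d < n.+2 by lia.
have dE : n.+1 - d = (Ordinal kn).+1 by rewrite /=; lia.
rewrite dE in dom_H.
have k_le : Ordinal kn <= n by rewrite /=; lia.
have [H' [Hg' HH' dom_H']] := prism_step k_le Hg dom_H.
by exists H'; split=> // m y z /GH/HH'.
Qed.

Lemma in_cells0 m (y : cyl K m) : in_cells 0 y <-> exists f : mono m n, y.1 = act f x.
Proof.
split=> [[f yf _]|[f yf]]; exists f => //.
(* The index is the largest value of [f] at level 0, or 0 if that level is empty; level 1 comes
   after it since [y.2] is monotone. *)
exists (\max_(c | (y.2 : mono m 1) c == I0) f c).
  by rewrite leq0n /=; apply/bigmax_leqP => c _; have := ltn_ord (f c); lia.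
move=> a; case: ifP => a0; first exact: leq_bigmax_cond.
apply/bigmax_leqP => c c0; apply: mono_le.
rewrite leqNgt; apply/negP => ac.
have := mono_le (y.2 : mono m 1) (ltnW ac); move: a0 c0.
rewrite -!(inj_eq val_inj) /=; lia.
Qed.

Lemma prism_attach : exists H, [/\ good H, saturated H, full H x &
  forall m y z, @G m y z -> @H m y z].
Proof.
have [H [Hg GH dom_H]] := prism_steps (leqnn n.+1).
have domE m (y : cyl K m) : sdom H y <-> sdom G y \/ exists f : mono m n, y.1 = act f x.
  by rewrite dom_H subnn in_cells0.
exists H; split=> //.
  move=> m y e e' ne0 /domE[/(G_sat e' ne0) Gy|Gy]; apply/domE; [by left|by right].
by apply/domE; right; exists (mono_id n); rewrite act_id.
Qed.
End Prism.

(** A non-full [x] of least dimension has full proper faces. Its initial vertex lies over 0, for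
    otherwise all of [x] would lie over 1, hence in K', where [A'] makes it full. *)
Lemma good_grow G : good G -> saturated G -> (exists n (x : K n), ~ full G x) ->
  exists H, [/\ good H, saturated H, forall m y z, @G m y z -> @H m y z &
    exists n (x : K n), ~ full G x /\ full H x].
Proof.
move=> Gg Gs [n0 [x0 nx0]]; have Gp : partial_smap G by case: Gg.
have exn : exists n, `[< exists x : K n, ~ full G x >] by exists n0; apply/asboolP; exists x0.
case: (ex_minnP exn) => n /asboolP[x nx] n_min.
have x_face m (f : mono m n) : ~ onto f -> full G (act f x).
  case: (onto_or_misses f) => // -[j fj] _.
  case: n x {nx} f j fj n_min => [|n] x f j fj n_min.
    by have := fj ord0; rewrite (ord1 j) (ord1 (f _)).
  rewrite (missing_factor fj) act_comp; apply: full_act => //.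
  apply: contrapT => nf; suff /n_min : `[< exists y : K n, ~ full G y >] by rewrite ltnn.
  by apply/asboolP; eexists; apply: nf.
have x_0 : s 0 (vertex ord0 x) = mono_cst 0 I0.
  have [s0|] := I2_cases ((s 0 (vertex ord0 x) : mono 0 1) ord0).
    by apply: monoP => a; rewrite (ord1 a) s0 mono_cstE.
  rewrite smap_act /= mono_compE mono_cstE => s1; exfalso; apply: nx.
  have [x' <-] : exists x', i n x' = x.
    apply: i_fiber1; apply: monoP => a; rewrite mono_cstE; apply: val_inj => /=.
    have := mono_le (s n x : mono n 1) (leq0n a : ord0 <= a); rewrite s1 /=.
    by have := ltn_ord ((s n x : mono n 1) a); lia.
  by case: Gg => _ _ _ GA' _; eexists; apply: GA'.
have [H [? ? ? ?]] := prism_attach Gg Gs nx x_face x_0.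
by exists H; split=> //; exists n, x.
Qed.

(** * Passage to a maximal extension *)

Record extension := Extension { ext_rel :> srel (cyl K) M;
  ext_good : good ext_rel; ext_sat : saturated ext_rel }.

Definition ext_le (G H : extension) := `[< forall m y z, @ext_rel G m y z -> @ext_rel H m y z >].

Lemma ext_chain (F : set extension) : total_on F ext_le ->
  exists U, forall G : extension, F G -> ext_le G U.
Proof.
move=> F_total; pose E0 := Extension good_base saturated_base.
(* Adjoining the base extension keeps the union good even for an empty chain. *)
pose F' (G : extension) := G = E0 \/ F G.
have F'_total (G H : extension) : F' G -> F' H -> ext_le G H \/ ext_le H G.
  move=> [->|FG] [->|FH]; last exact: F_total.
  - by left; apply/asboolP.
  - by left; apply/asboolP=> m y z; apply: good_base_sub (ext_good H).
  - by right; apply/asboolP=> m y z; apply: good_base_sub (ext_good G).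
pose U : srel (cyl K) M := fun m y z => exists2 G : extension, F' G & @ext_rel G m y z.
have U_good : good U.
  split.
  - split=> [l m f y z [G FG Gyz]|m y z z' [G FG Gz] [H FH Hz]].
      by exists G => //; case: (ext_good G) => -[+ _] _ _ _ _; apply.
    have [/asboolP GH|/asboolP HG] := F'_total _ _ FG FH.
      by case: (ext_good H) => -[_ +] _ _ _ _; apply; [apply: GH; apply: Gz|].
    by case: (ext_good G) => -[_ +] _ _ _ _; apply; [|apply: HG; apply: Hz].
  - by move=> m y z [G _]; case: (ext_good G) => _ + _ _ _; apply.
  - by move=> m y; exists E0; [left|case: (ext_good E0)].
  - by move=> m y e; exists E0; [left|case: (ext_good E0)].
  - by move=> k y s0 [G _]; case: (ext_good G) => _ _ _ _; apply.
have U_sat : saturated U.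
  move=> m y e e' ne0 [z [G FG Gz]].
  have [z' Gz'] : sdom (@ext_rel G) ((y, e') : cyl K m).
    by apply: (@ext_sat G _ _ e) => //; exists z.
  by exists z', G.
exists (Extension U_good U_sat) => G FG; apply/asboolP => m y z Gz.
by exists G => //; right.
Qed.

(** Zorn's lemma gives a maximal extension [G]. A non-full simplex would let [good_grow] enlarge it
    strictly, so [G] is total and is the graph of [A]. *)
Lemma cylinder_extension : exists A : smap (cyl K) M, [/\ p \os A = ssnd,
  A \os cyl_end K I0 = b,
  forall k : K 0, s 0 k = mono_cst 0 I0 -> cocartesian_edge p (A 1 (cyl_edge k)) &
  A \os sprod_map i (sid (Delta 1)) = A'].
Proof.
have [||G G_max] := ZL_preorder (Extension good_base saturated_base) (R := ext_le) _ _ ext_chain.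
- by move=> G; apply/asboolP.
- by move=> H G H' /asboolP HG /asboolP GH'; apply/asboolP => m y z /HG/GH'.
have Gg := ext_good G; have G_full n (x : K n) : full G x.
  apply: contrapT => nx.
  have [H [Hg Hs GH [m [y [nGy [z Hz]]]]]] :=
    good_grow Gg (@ext_sat G) (ex_intro _ n (ex_intro _ x nx)).
  have /asboolP HG : ext_le (Extension Hg Hs) G by apply: G_max; apply/asboolP.
  by apply: nGy; exists z; apply: HG.
have [Gp G_over Gb GA' Gc] := Gg.
have [m [y e]|A AP] := smap_of_graph Gp.
  exact: saturated_full (@ext_sat G) (G_full _ _).
have Gf := Gp.2.
exists A; split.
- by apply: smapP => m y; apply: (G_over _ _ _ (AP m y)).
- by apply: smapP => m y; apply: Gf (AP _ _) (Gb _ _).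
- by move=> k s0; apply: (Gc _ _ s0 (AP _ _)).
- by apply: smapP => m [y e]; apply: Gf (AP _ _) (GA' _ _ _).
Qed.

End Extension.

Lemma scompA W X Y Z (h : smap Y Z) (g : smap X Y) (f : smap W X) :
  h \os (g \os f) = h \os g \os f.
Proof. exact: smapP. Qed.

(** * Lifting maps to the fibers *)

Section FiberLift.
Variables (D M : sset) (p : smap M (Delta 1)) (hD : smap D (fiber p I1)).
Hypothesis hD_iso : is_siso hD.

Lemma inD_inj n (d d' : D n) : inD hD n d = inD hD n d' -> d = d'.
Proof.
have [h [hK _]] := hD_iso; move=> /= /val_inj e.
have hKE x : h n (hD n x) = x by exact: (congr1 (fun u : smap D D => u n x) hK).
by rewrite -(hKE d) e hKE.
Qed.

Lemma lift_inD X (f : smap X M) : p \os f = scst X I1 -> exists t, inD hD \os t = f.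
Proof.
move=> pf; have [h [_ Kh]] := hD_iso.
have f1 n x : in_fiber p I1 (f n x).
  by apply/eqP; exact: (congr1 (fun u : smap X (Delta 1) => u n x) pf).
pose f' n x : fiber p I1 n := exist _ (f n x) (f1 n x).
have f'_act m n (u : mono m n) x : f' m (act u x) = act u (f' n x).
  by apply: val_inj; rewrite /= smap_act.
exists (h \os SMap f'_act); apply: smapP => n x.
exact: (congr1 (fun u : smap (fiber p I1) (fiber p I1) => val (u n (f' n x))) Kh).
Qed.
End FiberLift.

(** * The contractible groupoid on two objects *)

Definition Jact m n (f : mono m n) (j : 'I_n.+1 -> bool) : 'I_m.+1 -> bool := j \o f.

Lemma Jact_id n j : Jact (mono_id n) j = j.
Proof. by apply: funext => a; rewrite /Jact /= mk_monoE. Qed.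

Lemma Jact_comp l m n (g : mono m n) (f : mono l m) j :
  Jact (mono_comp g f) j = Jact f (Jact g j).
Proof. by apply: funext => a; rewrite /Jact /= mk_monoE. Qed.

(* The simplices of the nerve of the groupoid with two uniquely isomorphic objects
   are arbitrary sequences of objects. *)
Definition J : sset := SSet Jact_id Jact_comp.

Section JHomotopy.
Variables (X Y : sset) (t : smap (sprod X J) Y).

Lemma Jsimplex_subproof n (phi : J n) l m (f : mono l m) (y : sprod X (Delta n) m) :
  t l ((act f y).1, phi \o ((act f y).2 : mono l n)) =
  act f (t m (y.1, phi \o (y.2 : mono m n))).
Proof.
rewrite -smap_act /=; congr (t l (_, _)).
by apply: funext => a; rewrite /= /Jact /= mono_compE.
Qed.

(** The composite of [t] with the map from X x Delta^n to X x J given by the simplex [phi] of J. *)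
Definition Jsimplex n (phi : J n) : Fun X Y n := SMap (Jsimplex_subproof phi).

Lemma act_Jsimplex m n (f : mono m n) phi : act f (Jsimplex phi) = Jsimplex (phi \o f).
Proof.
apply: smapP => l y /=; congr (t l (_, _)).
by apply: funext => a; rewrite /= mono_compE.
Qed.

(** The edge (false, true) of J has inverse (true, false); the 2-simplices (false, true, false) and
    (true, false, true) exhibit both composites as degenerate. *)
Lemma J_equivalent (f0 f1 : smap X Y) :
  (forall n x, t n (x, fun=> false) = f0 n x) ->
  (forall n x, t n (x, fun=> true) = f1 n x) -> equivalent_maps f0 f1.
Proof.
move=> tf0 tf1; exists (Jsimplex (fun a : 'I_2 => a == I1)).
rewrite /is_equivalence /is_composite /source /target /vertex /degen.
split.
- rewrite act_Jsimplex; apply: smapP => n y /=; rewrite -tf0; congr (t n (_, _)).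
  by apply: funext => a; rewrite /= mono_cstE.
- rewrite act_Jsimplex; apply: smapP => n y /=; rewrite -tf1; congr (t n (_, _)).
  by apply: funext => a; rewrite /= mono_cstE.
exists (Jsimplex (fun a : 'I_2 => a == I0)); split.
  exists (Jsimplex (fun a : 'I_3 => a == inord 1)).
  rewrite !act_Jsimplex; split; congr Jsimplex; apply: funext => a /=;
  by rewrite ?mk_monoE -!(inj_eq val_inj) /= ?mk_monoE !inordK //; case: (I2_cases a) => ->.
exists (Jsimplex (fun a : 'I_3 => a != inord 1)).
rewrite !act_Jsimplex; split; congr Jsimplex; apply: funext => a /=;
by rewrite ?mk_monoE -!(inj_eq val_inj) /= ?mk_monoE !inordK //; case: (I2_cases a) => ->.
Qed.
End JHomotopy.

(** * Gluing two solutions over the ends of J *)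

Section JCylinder.
Variables (K : sset) (s : smap K (Delta 1)).

Definition in_Jends n (y : sprod K J n) := in_fiber s I1 y.1 || [forall a, y.2 a == y.2 ord0].

Lemma in_Jends_act m n (f : mono m n) (y : sprod K J n) : in_Jends y -> in_Jends (act f y).
Proof.
case/orP=> [y1|/forallP y2]; apply/orP; [left; exact: in_fiber_act|right].
by apply/forallP=> a; rewrite /= /Jact /= (eqP (y2 _)) eq_sym (eqP (y2 _)).
Qed.

(* The subset K_1 x J u K x {0, 1} of K x J. *)
Definition Jends : sset := ssub in_Jends_act.

Variables (M : sset) (A0 A1 : smap (cyl K) M).
Hypothesis A01 : forall n (x : K n) e, in_fiber s I1 x -> A0 n (x, e) = A1 n (x, e).

(** Reading only the initial entry of the J-coordinate is compatible with restriction: over K_1 both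
    branches agree by [A01], and elsewhere that coordinate is constant. *)
Lemma Jglue_subproof m n (f : mono m n) (y : cyl Jends n) :
  (if (val (act f y).1).2 ord0 then A1 m ((val (act f y).1).1, (act f y).2)
   else A0 m ((val (act f y).1).1, (act f y).2)) =
  act f (if (val y.1).2 ord0 then A1 n ((val y.1).1, y.2) else A0 n ((val y.1).1, y.2)).
Proof.
case: y => [[[x j] P] e] /=; case/orP: (P) => /= [x1|/forallP j_cst].
  rewrite -(A01 _ x1) -(A01 _ (in_fiber_act f x1)) !if_same -smap_act //.
by rewrite /Jact /= (eqP (j_cst _)); case: ifP; rewrite -smap_act.
Qed.

Definition Jglue : smap (cyl Jends) M := SMap Jglue_subproof.
End JCylinder.

(** * Existence of the adjunct lift and its uniqueness up to equivalence *)

Theorem mainTheorem8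
  (C D M : sset) (hqC : quasicategory C) (hqD : quasicategory D)
  (p : smap M (Delta 1)) (hp : cartesian_fibration p)
  (hC : smap C (fiber p I0)) (hD : smap D (fiber p I1))
  (g : smap D C) (v : smap (cyl D) M) (hv : classifies hC hD g v)
  (K K' : sset) (s : smap K (Delta 1))
  (i : smap K' K) (hi : is_smono i) (hi1 : is_siso (fiber_map s i I1))
  (ta' : smap K' D) (a : smap K C)
  (hadj : adjunct hC hD v (s \os i) (a \os i) ta')
  (hleft : forall k : fiber s I0 0, left_adjoint_at hC ((a \os fiber_incl s I0) 0 k)) :
  (exists ta : smap K D, ta \os i = ta' /\ adjunct hC hD v s a ta) /\
  (forall ta1 ta2 : smap K D,
     ta1 \os i = ta' -> adjunct hC hD v s a ta1 ->
     ta2 \os i = ta' -> adjunct hC hD v s a ta2 ->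
     equivalent_maps ta1 ta2).
Proof.
have [inner_p _] := hp; have hD_iso := classifies_D hv.
have i_fiber1 n (x : K n) : s n x = mono_cst n I1 -> exists x', i n x' = x.
  move=> /eqP sx; have [h [_ Kh]] := hi1.
  have := congr1 (fun u : smap (fiber s I1) (fiber s I1) => val (u n (exist _ x sx))) Kh.
  by move=> /= e; eexists; apply: e.
have inC_over X (f : smap X C) : p \os (inC hC \os f) = scst X I0.
  by apply: smapP => n x; apply/eqP; exact: (valP (hC n (f n x))).
have lift_a (k : K 0) : s 0 k = mono_cst 0 I0 ->
    exists e, [/\ p 1 e = mono_id 1, source e = inC hC 0 (a 0 k) & cocartesian_edge p e].
  by move=> /eqP sk; apply: (hleft (exist _ k sk)).
have fiber_ext (f1 f2 : smap K D) n (x : K n) :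
    f1 \os i = f2 \os i -> in_fiber s I1 x -> f1 n x = f2 n x.
  move=> f12 /eqP/i_fiber1[x' <-].
  exact: (congr1 (fun u : smap K' D => u n x') f12).
split.
  have [A' [pA' [A'_0 A'_1 A'c A'v]]] := hadj.
  rewrite scompA in A'_0.
  have A'c' (k : K' 0) : s 0 (i 0 k) = mono_cst 0 I0 -> cocartesian_edge p (A' 1 (cyl_edge k)).
    by move=> /eqP sk; apply: (A'c (exist _ k sk)).
  have [A [pA A_0 Ac AA']] := cylinder_extension (s := s) (b := inC hC \os a) inner_p hi
    i_fiber1 (inC_over _ _) pA' A'_0 A'c' lift_a.
  have AA'E n x e : A n (i n x, e) = A' n (x, e).
    exact: (congr1 (fun u : smap (cyl K') M => u n (x, e)) AA').
  have [|ta taE] := lift_inD hD_iso (f := A \os cyl_end K I1).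
    by apply: smapP => n x;
      exact: (congr1 (fun u : smap (cyl K) (Delta 1) => u n (x, mono_cst n I1)) pA).
  have ta_i : ta \os i = ta'.
    apply: smapP => n x; apply: (inD_inj hD_iso).
    transitivity (A n (i n x, mono_cst n I1)).
      exact: (congr1 (fun u : smap K M => u n (i n x)) taE).
    rewrite AA'E; exact: (congr1 (fun u : smap K' M => u n x) A'_1).
  exists ta; split=> //; exists A; split=> //; split=> //.
    by move=> k; apply: Ac; apply/eqP; exact: (valP k).
  (* Condition (4): a simplex over 1 comes from K', where [A] restricts to [A'] and the condition is
     known. *)
  apply: smapP => n [[x /= sx] e] /=.
  have [x' xE] := i_fiber1 _ _ (eqP sx); rewrite -xE in sx *.
  have taE' : ta n (i n x') = ta' n x' by exact: (congr1 (fun u : smap K' D => u n x') ta_i).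
  rewrite AA'E taE'.
  exact: (congr1 (fun u : smap (cyl (fiber (s \os i) I1)) M =>
    u n ((exist _ x' sx : fiber (s \os i) I1 n), e)) A'v).
move=> ta1 ta2 ta1i [A1 [pA1 [A1_0 A1_1 A1c A1v]]] ta2i [A2 [pA2 [A2_0 A2_1 A2c A2v]]].
(* Over K_1, condition (4) expresses [A1] and [A2] through [v] and the lifts, which agree there
   because K_1 lies in the image of [i]. *)
have A12 n (x : K n) e : in_fiber s I1 x -> A1 n (x, e) = A2 n (x, e).
  move=> sx; have A1E := congr1 (fun u : smap (cyl (fiber s I1)) M =>
    u n ((exist _ x sx : fiber s I1 n), e)) A1v.
  have A2E := congr1 (fun u : smap (cyl (fiber s I1)) M =>
    u n ((exist _ x sx : fiber s I1 n), e)) A2v.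
  rewrite /= in A1E A2E; rewrite A1E A2E (fiber_ext ta1 ta2) //.
  by rewrite ta1i ta2i.
pose B' := Jglue A12; pose incl := ssub_incl (@in_Jends_act K s).
(* The extension result is applied to K x J, over Delta^1 through K, with [B'] prescribed on
   [Jends]: it is [A1] at the end false and [A2] at true. *)
have [|||||||B [pB _ _ BB']] := @cylinder_extension M p (sprod K J) (Jends s) (s \os sfst) incl
  (inC hC \os (a \os sfst)) B' inner_p _ _ _ _ _ _ _.
- by move=> n x y; apply: val_inj.
- move=> n x /eqP sx.
  by have xP : in_Jends s x by [apply/orP; left]; exists (exist _ x xP).
- exact: inC_over.
- apply: smapP => n [[x P] e] /=; case: ifP => _.
    exact: (congr1 (fun u : smap (cyl K) (Delta 1) => u n (x.1, e)) pA2).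
  exact: (congr1 (fun u : smap (cyl K) (Delta 1) => u n (x.1, e)) pA1).
- apply: smapP => n [x P] /=; case: ifP => _.
    exact: (congr1 (fun u : smap K M => u n x.1) A2_0).
  exact: (congr1 (fun u : smap K M => u n x.1) A1_0).
- move=> [x P] /= /eqP s0; case: ifP => _.
    exact: (A2c (exist _ x.1 s0)).
  exact: (A1c (exist _ x.1 s0)).
- by move=> x; apply: lift_a.
(* The restriction of [B] to level 1 lies in the fiber D and gives the J-homotopy from [ta1] to
   [ta2]. *)
have [|t tE] := lift_inD hD_iso (f := B \os cyl_end (sprod K J) I1).
  by apply: smapP => n x;
      exact: (congr1 (fun u : smap (cyl (sprod K J)) (Delta 1) => u n (x, mono_cst n I1)) pB).
have tE' n (x : K n) (c : bool) :
    inD hD n (t n (x, fun=> c)) = if c then A2 n (x, mono_cst n I1) else A1 n (x, mono_cst n I1).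
  transitivity (B n ((x, fun=> c), mono_cst n I1)).
    exact: (congr1 (fun u : smap (sprod K J) M => u n (x, fun=> c)) tE).
  have cP : in_Jends s ((x, fun=> c) : sprod K J n) by apply/orP; right; apply/forallP.
  exact: (congr1 (fun u : smap (cyl (Jends s)) M =>
    u n ((exist _ ((x, fun=> c) : sprod K J n) cP : Jends s n), mono_cst n I1)) BB').
apply: (@J_equivalent _ _ t) => n x; apply: (inD_inj hD_iso); rewrite tE'.
  exact: (congr1 (fun u : smap K M => u n x) A1_1).
exact: (congr1 (fun u : smap K M => u n x) A2_1).
Qed.
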